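(* Let $\mathcal L$ be the Fibonacci Lie algebra over a field $K$ with $\mathrm{char}\,K=2$. There exists a constant $C>0$ such that the points $(a,b)\in\mathbb Z^2$ of all nonzero nonconstant monomials $x^ay^b$ of the Euler characteristic $\mathbf E(\mathcal L,x,y)$, and of all nonzero monomials $x^ay^b$ of the series $\mathcal H(H_n(\mathcal L),x,y)$ of the homology groups, $n\ge1$, are bounded by a parabola-like curve on the plane, which in terms of the weight coordinates $(\xi,\eta)$ of $(a,b)$ is $$|\eta|<C\,\xi^{\theta},\qquad\theta:=\log_{1+\sqrt5}2 .$$
   Context: $R=K[t_i\mid i\ge 0]/(t_i^2\mid i\ge 0)$, $\partial_i=\partial/\partial t_i\in\mathrm{Der}\,R$. The pivot elements are the derivations $v_i=\partial_i+t_{i-1}(\partial_{i+1}+t_i(\partial_{i+2}+t_{i+1}(\partial_{i+3}+\cdots)))$, $i\ge1$, so $v_i=\partial_i+t_{i-1}v_{i+1}$. $\mathcal L=\mathrm{Lie}(v_1,v_2)$ is the Lie subalgebra of $\mathrm{Der}\,R$ generated by $v_1,v_2$. It is graded, $\mathcal L=\bigoplus_{a,b\ge0}\mathcal L_{a,b}$, with $\mathcal L_{a,b}$ spanned by commutators with $a$ factors $v_1$ and $b$ factors $v_2$. The exterior powers $\Lambda^n(\mathcal L)$ and the homology groups $H_n(\mathcal L)$ (trivial coefficients, Chevalley–Eilenberg complex) inherit the grading. For a graded space $V=\bigoplus V_{a,b}$ with finite dimensional components, $\mathcal H(V,x,y)=\sum\dim V_{a,b}\,x^ay^b$. The Euler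 characteristic is $$\mathbf E(\mathcal L,x,y)=\sum_{n\ge0}(-1)^n\mathcal H(\Lambda^n(\mathcal L),x,y)=\sum_{n\ge0}(-1)^n\mathcal H(H_n(\mathcal L),x,y).$$ With $\lambda=(1+\sqrt5)/2$, the weight coordinates of a point $(x,y)\in\mathbb R^2$ are $\xi=x\lambda+y\lambda^2$, $\eta=-x/\lambda+y/\lambda^2$. *)

(* Defs.v *)
From HB Require Import structures.
From mathcomp Require Import all_boot all_order all_algebra finmap.
From mathcomp Require Import boolp classical_sets functions fsbigop.
From mathcomp Require Import reals exp.
From mathcomp Require Import monalg.

Set Implicit Arguments.
Unset Strict Implicit.
Unset Printing Implicit Defensive.

Import Order.TTheory GRing.Theory Num.Theory.

Local Open Scope classical_set_scope.
Local Open Scope quotient_scope.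
Local Open Scope ring_scope.

Section Span.
Variables (K : fieldType) (V : lmodType K).

Definition span (S : set V) : set V :=
  [set x | exists2 s : seq (K * V), (forall cv, cv \in s -> S cv.2)
                                  & x = \sum_(cv <- s) cv.1 *: cv.2].

Lemma span0 S : span S 0.
Proof. by exists [::] => //; rewrite big_nil. Qed.

Lemma span_linear S c x y : span S x -> span S y -> span S (c *: x + y).
Proof.
move=> [s Ss ->] [r Sr ->].
exists ([seq (c * cv.1, cv.2) | cv <- s] ++ r).
  move=> cv; rewrite mem_cat => /orP[/mapP[dw dws ->] /=|]; last exact: Sr.
  exact: Ss.
rewrite big_cat big_map scaler_sumr; congr (_ + _).
by apply: eq_bigr => cv _; rewrite scalerA.
Qed.

Definition spanp (S : set V) : {pred V} := fun x => `[< span S x >].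

Lemma spanp_submod_closed S : submod_closed (spanp S).
Proof.
split=> [|c x y]; first exact/asboolP/span0.
by move=> /asboolP Sx /asboolP Sy; apply/asboolP/span_linear.
Qed.

HB.instance Definition _ S :=
  GRing.isSubmodClosed.Build K V (spanp S) (spanp_submod_closed S).

Definition lin_indep d (v : 'I_d -> V) :=
  forall c : 'I_d -> K, \sum_(i < d) c i *: v i = 0 -> forall i, c i = 0.

Definition is_basis (S : set V) d (v : 'I_d -> V) :=
  [/\ forall i, S (v i), lin_indep v & S `<=` span (range v)].

(* Dimension of a subspace S; by convention 0 if S is infinite dimensional. *)
Definition dim (S : set V) : nat :=
  xget 0%N [set d | exists v : 'I_d -> V, is_basis S v].

End Span.

(* V / span S *)
Definition quotmod (K : fieldType) (V : lmodType K) (S : set V) :=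
  {ideal_quot (spanp S)}.

Section QuotMod.
Variables (K : fieldType) (V : lmodType K) (S : set V).

HB.instance Definition _ := Choice.on (quotmod S).
HB.instance Definition _ := EqQuotient.on (quotmod S).
HB.instance Definition _ := GRing.Zmodule.on (quotmod S).

Definition qclass (x : V) : quotmod S := \pi_(quotmod S) x.

Lemma qclassP (x : quotmod S) : exists y, x = qclass y.
Proof. by exists (repr x); rewrite /qclass reprK. Qed.

Lemma qclassD x y : qclass (x + y) = qclass x + qclass y.
Proof. exact: pi_addr. Qed.

Lemma eq_qclass x y : qclass x = qclass y <-> span S (x - y).
Proof.
by split=> [/eqP|Sxy]; [|apply/eqP];
  rewrite -Quotient.idealrBE => *; apply/asboolP.
Qed.

Definition qscale (c : K) (x : quotmod S) : quotmod S := qclass (c *: repr x).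

Lemma qscale_class c x : qscale c (qclass x) = qclass (c *: x).
Proof.
apply/eq_qclass; rewrite -scalerBr -[_ *: _]addr0.
by apply: span_linear (span0 S); apply/eq_qclass; exact: reprK.
Qed.

Fact qscaleA a b x : qscale a (qscale b x) = qscale (a * b) x.
Proof. by have [y ->] := qclassP x; rewrite !qscale_class scalerA. Qed.

Fact qscale1 : left_id 1 qscale.
Proof. by move=> x; have [y ->] := qclassP x; rewrite qscale_class scale1r. Qed.

Fact qscaleDr : right_distributive qscale +%R.
Proof.
move=> c x y; have [u ->] := qclassP x; have [v ->] := qclassP y.
by rewrite -qclassD !qscale_class scalerDr qclassD.
Qed.

Fact qscaleDl x : {morph qscale^~ x : a b / a + b}.
Proof.
by move=> a b; have [y ->] := qclassP x; rewrite !qscale_class scalerDl qclassD.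
Qed.

HB.instance Definition _ := GRing.Zmodule_isLmodule.Build K (quotmod S)
  qscaleA qscale1 qscaleDr qscaleDl.

End QuotMod.

Section GeneratedIdeal.
Variables (A : comNzRingType) (I : Type) (g : I -> A).

Definition gen_ideal : {pred A} := fun p =>
  `[< exists s : seq (A * I), p = \sum_(qi <- s) qi.1 * g qi.2 >].

Lemma gen_ideal_closed : 1 \notin gen_ideal -> idealr_closed gen_ideal.
Proof.
split=> // [|a p q /asboolP[s ->] /asboolP[r ->]].
  by apply/asboolP; exists [::]; rewrite big_nil.
apply/asboolP; exists ([seq (a * qi.1, qi.2) | qi <- s] ++ r).
rewrite big_cat big_map mulr_sumr; congr (_ + _).
by apply: eq_bigr => qi _; rewrite mulrA.
Qed.

Lemma one_notin_gen_ideal (B : comNzRingType) (phi : {rmorphism A -> B}) :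
  (forall i, phi (g i) = 0) -> 1 \notin gen_ideal.
Proof.
move=> phig; apply/asboolP => -[s /(congr1 phi)].
rewrite rmorph1 rmorph_sum big1 => [/eqP|qi _]; first by rewrite oner_eq0.
by rewrite rmorphM phig mulr0.
Qed.

End GeneratedIdeal.

Section TruncatedPolynomials.
Variable K : fieldType.

Local Notation ipoly := {malg K[{cmonom nat}]}.

Definition ivar (i : nat) : ipoly := << ucm i >>.

Definition sq_ideal : {pred ipoly} := gen_ideal (fun i => ivar i ^+ 2).

Lemma sq_ideal_closed : idealr_closed sq_ideal.
Proof.
pose phi : {rmorphism ipoly -> K} := mcoeff (@mone {cmonom nat}).
apply: gen_ideal_closed; apply: (one_notin_gen_ideal (phi := phi)) => i.
suff phiX : phi (ivar i) = 0 by rewrite rmorphXn phiX expr0n.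
rewrite /phi /= mcoeffU; case: eqP => // h.
by have := cmUU i; rewrite h cm1.
Qed.

HB.instance Definition _ := isIdealr.Build {malg K[{cmonom nat}]} sq_ideal sq_ideal_closed.

Definition trunc := {ideal_quot sq_ideal}.
HB.instance Definition _ := Choice.on trunc.
HB.instance Definition _ := EqQuotient.on trunc.
HB.instance Definition _ := GRing.ComNzRing.on trunc.

Definition tclass (p : ipoly) : trunc := \pi_trunc p.

Lemma tclassD p q : tclass (p + q) = tclass p + tclass q.
Proof. exact: pi_addr. Qed.

Lemma tclassM p q : tclass (p * q) = tclass p * tclass q.
Proof. exact: pi_mulr. Qed.

Lemma tclass1 : tclass 1 = 1.
Proof. exact: pi_oner. Qed.

Definition tscale (c : K) (f : trunc) : trunc := tclass c%:MP * f.

Fact tscaleA a b f : tscale a (tscale b f) = tscale (a * b) f.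
Proof. by rewrite /tscale mpolyCM tclassM mulrA. Qed.

Fact tscale1 : left_id 1 tscale.
Proof. by move=> f; rewrite /tscale mpolyC1E tclass1 mul1r. Qed.

Fact tscaleDr : right_distributive tscale +%R.
Proof. by move=> c f g; rewrite /tscale mulrDr. Qed.

Fact tscaleDl f : {morph tscale^~ f : a b / a + b}.
Proof. by move=> a b; rewrite /tscale raddfD tclassD mulrDl. Qed.

HB.instance Definition _ := GRing.Zmodule_isLmodule.Build K trunc
  tscaleA tscale1 tscaleDr tscaleDl.

Definition tvar (i : nat) : trunc := tclass (ivar i).

Definition ipderiv (i : nat) (p : ipoly) : ipoly :=
  \sum_(m <- msupp p) << p@_m *+ m i *g divcm m (ucm i) >>.

(* In characteristic 2, ipderiv i preserves the ideal sq_ideal, so that the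
   result does not depend on the representative. *)
Definition pderiv (i : nat) (f : trunc) : trunc :=
  tclass (ipderiv i (repr f)).

(* The pivot elements v_i, i >= 1, unfolded as
     v_i = d_i + t_(i-1) d_(i+1) + t_(i-1) t_i d_(i+2) + ... ;
   pderiv k f = 0 for k large, so that the sum below has finite support. *)
Definition pivot (i : nat) (f : trunc) : trunc :=
  \sum_(j \in [set: nat]) (\prod_(k < j) tvar (i.-1 + k)) * pderiv (i + j) f.

End TruncatedPolynomials.

Section LieSubalgebra.
Variables (K : fieldType) (V : lmodType K).

Definition commutator (D E : V -> V) : V -> V := fun f => D (E f) - E (D f).

Definition lie_subalgebra (S : set (V -> V)) :=
  [/\ S 0, forall (c : K) D E, S D -> S E -> S (c *: D + E)
    & forall D E, S D -> S E -> S (commutator D E)].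

End LieSubalgebra.

Section FibonacciLieAlgebra.
Variable K : fieldType.

(* The Lie algebra generated by v_1 and v_2. As v_1 and v_2 are derivations of
   trunc K in characteristic 2, this is the smallest Lie subalgebra of the Lie
   algebra of derivations containing them: derivations form a subspace of
   trunc K -> trunc K that is closed under commutators. *)
Definition in_fib : {pred trunc K -> trunc K} := fun D =>
  `[< smallest (@lie_subalgebra K (trunc K))
        [set @pivot K 1; @pivot K 2] D >].

Lemma in_fib_lie_subalgebra :
  lie_subalgebra [set D : trunc K -> trunc K | in_fib D].
Proof.
split=> [|c D E /asboolP SD /asboolP SE|D E /asboolP SD /asboolP SE];
  apply/asboolP => S [S_lie vS].
- by case: S_lie.
- by case: (S_lie) => _ + _; apply; [apply: SD|apply: SE].
- by case: (S_lie) => _ _; apply; [apply: SD|apply: SE].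
Qed.

Lemma in_fib_submod_closed : submod_closed in_fib.
Proof. by case: in_fib_lie_subalgebra. Qed.

HB.instance Definition _ := GRing.isSubmodClosed.Build K (trunc K -> trunc K)
  in_fib in_fib_submod_closed.

Record fib : predArgType :=
  Fib { fib_val :> trunc K -> trunc K; fib_valP : in_fib fib_val }.
HB.instance Definition _ := [isSub for fib_val].
HB.instance Definition _ := [Choice of fib by <:].
HB.instance Definition _ := [SubChoice_isSubLmodule of fib by <:].

Definition fib_br (x y : fib) : fib :=
  Fib (let: And3 _ _ h := in_fib_lie_subalgebra in
       h x y (fib_valP x) (fib_valP y)).

Lemma in_fib_pivot1 : in_fib (@pivot K 1).
Proof. by apply/asboolP => S [_]; apply; left. Qed.

Lemma in_fib_pivot2 : in_fib (@pivot K 2).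
Proof. by apply/asboolP => S [_]; apply; right. Qed.

Definition fib_v1 := Fib in_fib_pivot1.
Definition fib_v2 := Fib in_fib_pivot2.

Inductive fib_commutator : nat -> nat -> fib -> Prop :=
| fib_commutator_v1 : fib_commutator 1 0 fib_v1
| fib_commutator_v2 : fib_commutator 0 1 fib_v2
| fib_commutator_br a b a' b' x x' :
    fib_commutator a b x -> fib_commutator a' b' x' ->
    fib_commutator (a + a') (b + b') (fib_br x x').

Definition fib_comp (a b : nat) : set fib := span (fib_commutator a b).

End FibonacciLieAlgebra.

Section ChevalleyEilenberg.
Variables (K : fieldType) (L : lmodType K) (br : L -> L -> L).
Variable gr : nat -> nat -> set L.

Definition multilinear_rel n : set {malg K[{ffun 'I_n -> L}]} :=
  [set r | exists (i : 'I_n) (c : K) (x y z : {ffun 'I_n -> L}),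
    [/\ x i = c *: y i + z i,
        forall j, j != i -> x j = y j /\ x j = z j
      & r = << x >> - c *: << y >> - << z >>]].

Definition alternating_rel n : set {malg K[{ffun 'I_n -> L}]} :=
  [set r | exists (i j : 'I_n) (x : {ffun 'I_n -> L}),
    [/\ i != j, x i = x j & r = << x >>]].

(* The n-th exterior power, as a quotient of the free module on n-families. *)
Definition ext n := quotmod (@multilinear_rel n `|` @alternating_rel n).
HB.instance Definition _ n := GRing.Lmodule.on (ext n).

Definition wedge n (x : {ffun 'I_n -> L}) : ext n := qclass _ << x >>.

Definition ext_comp n (a b : nat) : set (ext n) :=
  span [set w | exists (d e : 'I_n -> nat) (x : {ffun 'I_n -> L}),
    [/\ forall i, gr (d i) (e i) (x i),
        (\sum_(i < n) d i)%N = a, (\sum_(i < n) e i)%N = b & w = wedge x]].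

(* The sum over i < j' of (-1)^(i + j') [x_i, x_j'] /\ x_0 /\ ... /\ x_(n+1)
   with the factors x_i and x_j' omitted; j' = lift i j ranges over the indices
   above i when j ranges over the indices with i <= j. *)
Definition ce_wedge n : {ffun 'I_n.+1 -> L} -> ext n :=
  match n with
  | 0 => fun=> 0
  | m.+1 => fun x =>
      \sum_(i < m.+2) \sum_(j < m.+1 | (i <= j)%N)
        (-1) ^+ (i + lift i j) *:
          wedge [ffun k : 'I_m.+1 =>
                   if unlift ord0 k is Some k' then x (lift i (lift j k'))
                   else br (x i) (x (lift i j))]
  end.

(* The differential. Its value does not depend on the representative, ce_wedge
   being multilinear and alternating as soon as br is. *)
Definition ce_diff n (w : ext n.+1) : ext n :=
  let u : {malg K[{ffun 'I_n.+1 -> L}]} := repr w in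
  \sum_(x <- msupp u) u@_x *: ce_wedge x.

Definition cycles n : set (ext n) :=
  match n with
  | 0 => setT
  | m.+1 => [set w | ce_diff w = 0]
  end.

Definition mod_boundaries n := quotmod (range (@ce_diff n)).
HB.instance Definition _ n := GRing.Lmodule.on (mod_boundaries n).

(* The component of degree (a, b) of H_n = cycles n / range (ce_diff n), as a
   subspace of ext n / range (ce_diff n). *)
Definition homology_comp n (a b : nat) : set (mod_boundaries n) :=
  qclass _ @` (@cycles n `&` @ext_comp n a b).

End ChevalleyEilenberg.

Section Series.
Variable K : fieldType.

(* Series in x, y are given by the coefficients of the monomials x^a y^b. *)
Definition hilbert_ext (n a b : nat) : nat :=
  dim (@ext_comp K (fib K) (@fib_comp K) n a b).

Definition hilbert_homology (n a b : nat) : nat :=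
  dim (@homology_comp K (fib K) (@fib_br K) (@fib_comp K) n a b).

(* Finitely supported sum: the component (a, b) of the n-th exterior power
   vanishes for n > a + b. *)
Definition euler_char (a b : nat) : int :=
  \sum_(n \in [set: nat]) (-1) ^+ n * (hilbert_ext n a b)%:Z.

End Series.

Section Weights.
Variable R : realType.

Definition golden : R := (1 + Num.sqrt 5) / 2.

Definition weight_xi (x y : R) : R := x * golden + y * golden ^+ 2.

Definition weight_eta (x y : R) : R := - x / golden + y / golden ^+ 2.

Definition theta : R := ln 2 / ln (1 + Num.sqrt 5).

End Weights.

(* Main.v *)
(* Bracketing the pivots gives [v_n, v_m] = t_(n-1) ... t_(m-3) v_(m+1) for
   n < m, so the span of the monomials t_s v_n, with s a set of indices at most
   n - 3, is closed under the bracket. Give v_n the weight (lambda^n, mu^n) with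
   mu = -1/lambda, and t_n the opposite one: the weight of t_s v_n is the pair
   of weight coordinates (xi, eta) of its bidegree. Here eta is bounded and
   lambda^(n-2) <= xi, so L has fewer than 2^N dimensions of weight
   xi < lambda^(N-2).
   If the component (a, b) of the n-th exterior power is nonzero, it contains a
   nonzero wedge of homogeneous elements x_1, ..., x_n; these are linearly
   independent, so at least about n / 2 of them have xi at least about n^c with
   2^c = lambda. Hence xi(a, b) is at least about n^(1 + c), where
   2^(1 + c) = 1 + sqrt 5, whereas |eta(a, b)| = O(n). Only the fact that the
   monomials span is needed, not that they form a basis of L. *)
Require Import Defs.
From HB Require Import structures.
From mathcomp Require Import all_boot all_order all_algebra finmap.
From mathcomp Require Import boolp classical_sets functions fsbigop.
From mathcomp Require Import reals exp monalg.
From mathcomp Require Import ring lra zify.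
(* [span] is also a constant of [vector]. *)
Import Defs.

Set Implicit Arguments.
Unset Strict Implicit.
Unset Printing Implicit Defensive.

Import Order.TTheory GRing.Theory Num.Theory.

Local Open Scope classical_set_scope.
Local Open Scope quotient_scope.
Local Open Scope ring_scope.

(** * Derivations, generated ideals and quotient rings *)

Lemma derivation_gen_ideal (A : comNzRingType) (I : Type) (g : I -> A)
    (D : A -> A) :
    {morph D : p q / p + q} -> (forall p q, D (p * q) = D p * q + p * D q) ->
    (forall i, D (g i) = 0) ->
  forall p, p \in gen_ideal g -> D p \in gen_ideal g.
Proof.
move=> DD DM Dg p /asboolP[s ->]; apply/asboolP.
exists [seq (D qi.1, qi.2) | qi <- s]; rewrite big_map.
have D0 : D 0 = 0 by apply: (addIr (D 0)); rewrite -DD !add0r.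
rewrite (big_morph D DD D0); apply: eq_bigr => qi _.
by rewrite DM Dg mulr0 addr0.
Qed.

Lemma derivation_quot (A B : comNzRingType) (pi : A -> B)
    (D : A -> A) (D' : B -> B) :
    (forall p q, pi (p + q) = pi p + pi q) ->
    (forall p q, pi (p * q) = pi p * pi q) ->
    (forall f, exists p, f = pi p) -> (forall p, D' (pi p) = pi (D p)) ->
    (forall p q, D (p * q) = D p * q + p * D q) ->
  forall f g, D' (f * g) = D' f * g + f * D' g.
Proof.
move=> piD piM piP D'pi DM f g; have [p ->] := piP f; have [q ->] := piP g.
by rewrite -piM !D'pi DM piD !piM.
Qed.

Lemma mem_gen_ideal (A : comNzRingType) (I : Type) (g : I -> A) i :
  g i \in gen_ideal g.
Proof. by apply/asboolP; exists [:: (1, i)]; rewrite big_seq1 mul1r. Qed.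

(** * Partial derivatives on the truncated polynomial ring *)

Section Derivations.
Variable K : fieldType.
Local Notation ipoly := {malg K[{cmonom nat}]}.
Local Notation trunc := (trunc K).
Local Notation t_ := (tvar K).

Lemma mul_malgU (c d : K) (m n : {cmonom nat}) :
  << c *g m >> * << d *g n >> = << c * d *g mmul m n >> :> ipoly.
Proof. exact: fgmulUU. Qed.

Lemma malg_ind (P : ipoly -> Prop) :
  P 0 -> (forall p q, P p -> P q -> P (p + q)) ->
  (forall c m, P << c *g m >>) -> forall p, P p.
Proof. by move=> P0 PD PU p; rewrite [p]monalgE; apply: big_ind. Qed.

(** As a linear extension from monomials, [ipderiv i] inherits additivity from [mmap]. *)
Lemma ipderivE i :
  @ipderiv K i =
  mmap (@mkmalgU _ K mone) (fun m => << 1 *+ m i *g divcm m (ucm i) >>).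
Proof.
apply/funext => p; apply: eq_bigr => m _.
by rewrite mul_malgU mul1m mulrnAr mulr1.
Qed.

Lemma ipderivD i : {morph @ipderiv K i : p q / p + q}.
Proof. by move=> p q; rewrite !ipderivE raddfD. Qed.

Lemma ipderivU i c m :
  ipderiv i << c *g m >> = << c *+ m i *g divcm m (ucm i) >> :> ipoly.
Proof. by rewrite ipderivE mmapU mul_malgU mul1m mulrnAr mulr1. Qed.

Lemma ipderiv0 i : ipderiv i 0 = 0 :> ipoly.
Proof. by rewrite ipderivE raddf0. Qed.

Lemma ipderivM i (p q : ipoly) :
  ipderiv i (p * q) = ipderiv i p * q + p * ipderiv i q.
Proof.
elim/malg_ind: p => [|p p' IHp IHp'|c m].
- by rewrite ipderiv0 !mul0r ipderiv0 addr0.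
- rewrite mulrDl 2!ipderivD.
  by rewrite (mulrDl (ipderiv i p)) (mulrDl p) addrACA;
    congr (_ + _); [exact: IHp|exact: IHp'].
elim/malg_ind: q => [|q q' IHq IHq'|d n].
- by rewrite ipderiv0 !mulr0 ipderiv0 addr0.
- rewrite mulrDr 2!ipderivD.
  by rewrite (mulrDr (ipderiv i _)) (mulrDr _ (ipderiv i q)) addrACA;
    congr (_ + _); [exact: IHq|exact: IHq'].
have -> : ipderiv i (<< c *g m >> * << d *g n >>) =
    << c *+ m i * d *g divcm (mmul m n) (ucm i) >> +
    << c * (d *+ n i) *g divcm (mmul m n) (ucm i) >>.
  by rewrite (mul_malgU c d m n) ipderivU cmM mulrnDr mulrnAl mulrnAr monalgUD.
have -> : ipderiv i << c *g m >> * << d *g n >> =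
    << c *+ m i * d *g mmul (divcm m (ucm i)) n >> :> ipoly.
  exact: (etrans (congr1 ( *%R^~ _) (ipderivU i c m)) (mul_malgU _ _ _ _)).
have -> : << c *g m >> * ipderiv i << d *g n >> =
    << c * (d *+ n i) *g mmul m (divcm n (ucm i)) >> :> ipoly.
  exact: (etrans (congr1 ( *%R _) (ipderivU i d n)) (mul_malgU _ _ _ _)).
(* Dividing a product by t_i can be done in the first factor if t_i occurs there. Otherwise
   truncated subtraction of exponents breaks the identity, but then the coefficient, a multiple of
   the exponent, is zero. *)
have divM (e : K) (a b : {cmonom nat}) : (a i = 0%N -> e = 0) ->
    << e *g divcm (mmul a b) (ucm i) >> = << e *g mmul (divcm a (ucm i)) b >>
    :> ipoly.
  case: (eqVneq (a i) 0%N) => [a0 /(_ a0) ->|ai _].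
    by rewrite !monalgU0.
  suff -> : divcm (mmul a b) (ucm i) = mmul (divcm a (ucm i)) b by [].
  apply/eqP/cmP => j.
  rewrite divcmE !cmM divcmE ucmE.
  by case: eqP => [<-|_]; lia.
apply: congr2; first by apply: divM => ->; rewrite mulr0n mul0r.
rewrite (mulmC m n) (mulmC m); apply: divM => ->.
by rewrite mulr0n mulr0.
Qed.

Lemma ipderiv_var i j : ipderiv i (ivar K j) = (i == j)%:R.
Proof.
rewrite /ivar ipderivU ucmE eq_sym; case: eqP => [->|_].
  suff -> : divcm (ucm j) (ucm j) = mone :> {cmonom nat} by [].
  by apply/eqP/cmP => k; rewrite divcmE cm1 subnn.
by rewrite mulr0n monalgU0.
Qed.

Lemma tclassP (f : trunc) : exists p, f = tclass p.
Proof. by exists (repr f); rewrite /tclass reprK. Qed.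

Lemma tclass0 : tclass 0 = 0 :> trunc.
Proof. by apply: (addIr (tclass (0 : ipoly))); rewrite -tclassD 2!add0r. Qed.

Lemma tvar_sq i : t_ i * t_ i = 0.
Proof.
rewrite -(tclassM (ivar K i)) -tclass0; apply/eqP.
rewrite -Quotient.idealrBE subr0 -expr2.
exact: (mem_gen_ideal (fun i => ivar K i ^+ 2)).
Qed.

Lemma scale_truncE (c : K) (f : trunc) : c *: f = tclass c%:MP * f.
Proof. by []. Qed.

Lemma trunc_scaleAl (c : K) (f g : trunc) : c *: (f * g) = c *: f * g.
Proof. exact: mulrA. Qed.

HB.instance Definition _ :=
  GRing.Lmodule_isLalgebra.Build K trunc trunc_scaleAl.
HB.instance Definition _ := GRing.Lalgebra_isComAlgebra.Build K trunc.

(** The variables generate the algebra: a monomial is reached by induction on its degree, splitting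
    off one variable at a time. *)
Lemma trunc_ind (P : trunc -> Prop) :
    P 1 -> (forall f g, P f -> P g -> P (f + g)) ->
    (forall c f, P f -> P (c *: f)) -> (forall i f, P f -> P (t_ i * f)) ->
  forall f, P f.
Proof.
move=> P1 PD PZ PX f; have [p ->] := tclassP f.
have P0 : P 0 by rewrite -(scale0r 1); exact: PZ.
elim/malg_ind: p => [|p q Pp Pq|c m]; first by rewrite tclass0.
  by rewrite tclassD; apply: PD.
have -> : << c *g m >> = c%:MP * << m >> :> ipoly.
  by rewrite (mul_malgU c 1) mulr1 mul1m.
rewrite (tclassM c%:MP) -scale_truncE; apply: PZ => {c}.
have [n] := ubnP (mdeg m); elim: n m => // n IH m; rewrite ltnS => le_mn.
have [m1|/negP/negP m_neq0] := boolP (mdeg m == 0%N).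
  have -> : m = mone by apply: mdeg_eq0I; apply/eqP.
  by rewrite -[<< _ >>]/(1 : ipoly) tclass1.
have [i mi] : exists i, m i != 0%N.
  apply: contrapT => m0; case/negP: m_neq0; rewrite mdeg_eq0; apply/cmP => i.
  by rewrite cm1; apply: contrapT => mi; apply: m0; exists i; apply/eqP.
have mE : m = mmul (ucm i) (divcm m (ucm i)).
  by apply/eqP/cmP => j; rewrite cmM divcmE ucmE; case: eqP => [<-|_]; lia.
have -> : << m >> = ivar K i * << divcm m (ucm i) >> :> ipoly.
  by rewrite {1}mE /ivar mul_malgU mulr1.
rewrite (tclassM (ivar K i)); apply/PX/IH; move: le_mn.
by rewrite {1}mE mdegM mdegU.
Qed.

Hypothesis charK : 2%N \in [pchar K].

(** The derivative of t_j^2 is 2 t_j d_i(t_j), which is zero in characteristic 2. *)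
Lemma ipderiv_ideal i p : p \in @sq_ideal K -> ipderiv i p \in @sq_ideal K.
Proof.
apply: derivation_gen_ideal (ipderivD i) (ipderivM i) _ _ => j.
have ip_pchar (q : ipoly) : q + q = 0.
  by rewrite -mulr2n -mulr_natr -mpolyC_nat (pcharf0 charK) malgC0E mulr0.
by rewrite expr2 ipderivM (mulrC (ivar K j)); exact: ip_pchar.
Qed.

Lemma ipderivB i : {morph @ipderiv K i : p q / p - q}.
Proof. by move=> p q; rewrite ipderivE raddfB. Qed.

(** [p] and the chosen representative of its class differ by an element of [sq_ideal], which
    [ipderiv i] preserves. *)
Lemma pderiv_class i (p : ipoly) : pderiv i (tclass p) = tclass (ipderiv i p).
Proof.
apply/eqP; rewrite -Quotient.idealrBE.
rewrite -ipderivB; apply: ipderiv_ideal.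
by rewrite Quotient.idealrBE; apply/eqP; exact: reprK.
Qed.

Lemma pderivD i : {morph @pderiv K i : f g / f + g}.
Proof.
move=> f g; have [p ->] := tclassP f; have [q ->] := tclassP g.
by rewrite -tclassD 3!pderiv_class ipderivD tclassD.
Qed.

Lemma pderivM i (f g : trunc) :
  pderiv i (f * g) = pderiv i f * g + f * pderiv i g.
Proof.
exact: (@derivation_quot {malg K[{cmonom nat}]} trunc (@tclass K) _ _
  (@tclassD K) (@tclassM K) tclassP (pderiv_class i) (ipderivM i)).
Qed.

Lemma pderivC i (c : K) : pderiv i (tclass c%:MP) = 0.
Proof.
rewrite pderiv_class ipderivU cm1 mulr0n monalgU0.
exact: tclass0.
Qed.

Lemma pderiv_var i j : pderiv i (t_ j) = (i == j)%:R.
Proof.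
rewrite /tvar pderiv_class ipderiv_var; case: eqP => _; first exact: tclass1.
exact: tclass0.
Qed.

Lemma pderivZ i (c : K) (f : trunc) : pderiv i (c *: f) = c *: pderiv i f.
Proof. by rewrite 2!scale_truncE pderivM pderivC mul0r add0r. Qed.

End Derivations.

(** * Linear spans *)

Section SpanTheory.
Variables (K : fieldType) (V : lmodType K).
Implicit Types (S T : set V).

Lemma span_mem S x : S x -> span S x.
Proof.
move=> Sx; exists [:: (1, x)]; last by rewrite big_seq1 scale1r.
by move=> cv; rewrite inE => /eqP ->.
Qed.

Lemma spanD S x y : span S x -> span S y -> span S (x + y).
Proof. by move=> Sx Sy; rewrite -(scale1r x); exact: span_linear. Qed.

Lemma spanZ S c x : span S x -> span S (c *: x).
Proof. by move=> Sx; rewrite -[_ *: _]addr0; exact: span_linear (span0 S). Qed.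

Lemma spanN S x : span S x -> span S (- x).
Proof. by rewrite -scaleN1r; exact: spanZ. Qed.

Lemma span_ind S (P : V -> Prop) :
    P 0 -> (forall c x y, P x -> P y -> P (c *: x + y)) -> S `<=` P ->
  span S `<=` P.
Proof.
move=> P0 PL SP _ [s Ss ->]; elim: s Ss => [_|cv s IH Ss].
  by rewrite big_nil.
rewrite big_cons; apply: PL; first by apply/SP/Ss; rewrite inE eqxx.
by apply: IH => dw dws; apply: Ss; rewrite inE dws orbT.
Qed.

Lemma span_sub S T : S `<=` span T -> span S `<=` span T.
Proof.
by apply: span_ind => [|c x y Sx Sy]; [exact: span0|exact: span_linear].
Qed.

End SpanTheory.

Lemma big_uniq_ord (R : Type) (idx : R) (op : Monoid.com_law idx)
    (s : seq nat) n (F : nat -> R) :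
  uniq s -> {in s, forall i, i < n}%N ->
  \big[op/idx]_(i <- s) F i = \big[op/idx]_(i < n | val i \in s) F i.
Proof.
move=> us sn; rewrite -(big_mkord (mem s)) -[RHS]big_filter.
apply: perm_big; apply: uniq_perm; rewrite ?filter_uniq ?iota_uniq // => i.
rewrite mem_filter mem_index_iota /=.
by case: (boolP (i \in s)) => // /sn ->.
Qed.

(** * Derivations of a commutative algebra *)

Section Derivation.
Variables (K : fieldType) (A : comAlgType K).

Definition derivation (D : A -> A) :=
  [/\ {morph D : f g / f + g}, forall (c : K) f, D (c *: f) = c *: D f
    & forall f g, D (f * g) = D f * g + f * D g].

Section Rules.
Variables (D : A -> A) (derD : derivation D).

Lemma derivD f g : D (f + g) = D f + D g. Proof. by case: derD. Qed.

Lemma derivZ (c : K) f : D (c *: f) = c *: D f. Proof. by case: derD. Qed.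

Lemma derivM f g : D (f * g) = D f * g + f * D g. Proof. by case: derD. Qed.

Lemma deriv0 : D 0 = 0.
Proof. by apply: (addIr (D 0)); rewrite -derivD !add0r. Qed.

Lemma deriv1 : D 1 = 0.
Proof.
by apply: (addIr (D 1)); rewrite add0r -[in RHS](mulr1 1) derivM !mulr1 mul1r.
Qed.

Lemma deriv_prod_eq0 (I : Type) (s : seq I) (P : pred I) (F : I -> A) :
  (forall i, P i -> D (F i) = 0) -> D (\prod_(i <- s | P i) F i) = 0.
Proof.
move=> DF; elim/big_rec: _ => [|i f Pi Df]; first exact: deriv1.
by rewrite derivM DF // Df mul0r mulr0 addr0.
Qed.

End Rules.

Lemma derivation_commutator D E :
  derivation D -> derivation E -> derivation (commutator D E).
Proof.
rewrite /commutator => dD dE; split=> [f g|c f|f g].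
- by rewrite (derivD dE) (derivD dD) (derivD dD f) (derivD dE) opprD addrACA.
- by rewrite (derivZ dE) (derivZ dD) (derivZ dD c f) (derivZ dE) scalerBr.
rewrite (derivM dE) (derivM dD f) (derivD dD) (derivD dE).
by rewrite !(derivM dD) !(derivM dE); ring.
Qed.

Lemma derivation0 : derivation (fun=> 0).
Proof.
by split=> [f g|c f|f g]; rewrite ?addr0 ?scaler0 // mul0r mulr0 addr0.
Qed.

Lemma derivation_lin (c : K) D E :
  derivation D -> derivation E -> derivation (c *: D + E).
Proof.
move=> dD dE; split=> [f g|k f|f g]; rewrite !fctE.
- by rewrite (derivD dD) (derivD dE) scalerDr addrACA.
- by rewrite (derivZ dD) (derivZ dE) scalerDr !scalerA mulrC.
rewrite (derivM dD) (derivM dE) scalerDr scalerAl scalerAr.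
by rewrite mulrDl mulrDr addrACA.
Qed.

Lemma derivation_mull a D : derivation D -> derivation (fun f => a * D f).
Proof.
move=> dD; split=> [f g|c f|f g]; first by rewrite (derivD dD) mulrDr.
  by rewrite (derivZ dD) scalerAr.
by rewrite (derivM dD); ring.
Qed.

End Derivation.

(** * Brackets of pivot elements over an abstract algebra with variables t_i *)

Section Pivots.
Variables (K : fieldType) (A : comAlgType K) (t : nat -> A) (d : nat -> A -> A).
Hypothesis dP : forall i, derivation (d i).
Hypothesis dt : forall i j, d i (t j) = (i == j)%:R.
Hypothesis t_ind : forall P : A -> Prop,
  P 1 -> (forall f g, P f -> P g -> P (f + g)) ->
  (forall (c : K) f, P f -> P (c *: f)) -> (forall i f, P f -> P (t i * f)) ->
  forall f, P f.

(** [t_ind] expresses that the [t i] generate the algebra, and a derivation is determined by its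
    values on generators. *)
Lemma derivation_ext D E : derivation D -> derivation E ->
  (forall i, D (t i) = E (t i)) -> D =1 E.
Proof.
move=> dD dE DE; apply: t_ind => [|f g Ef Eg|c f Ef|i f Ef].
- by rewrite (deriv1 dD) (deriv1 dE).
- by rewrite (derivD dD) (derivD dE) Ef Eg.
- by rewrite (derivZ dD) (derivZ dE) Ef.
- by rewrite (derivM dD) (derivM dE) DE Ef.
Qed.

Lemma prod_recl n l :
  \prod_(k < l.+1) t (n + k) = t n * \prod_(k < l) t (n.+1 + k).
Proof.
rewrite big_ord_recl addn0; congr (_ * _); apply: eq_bigr => k _.
by rewrite /= /bump addSnnS.
Qed.

Definition pivot_of i f : A :=
  \sum_(j \in [set: nat]) (\prod_(k < j) t (i.-1 + k)) * d (i + j) f.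
Local Notation v := pivot_of.

(* f is a polynomial in t_0, ..., t_(N-1). *)
Definition inert N f := forall k, (N <= k)%N -> d k f = 0.

Lemma inertW M N f : (M <= N)%N -> inert M f -> inert N f.
Proof. by move=> MN Mf k /(leq_trans MN)/Mf. Qed.

Lemma inertD N f g : inert N f -> inert N g -> inert N (f + g).
Proof. by move=> Nf Ng k Nk; rewrite (derivD (dP k)) Nf // Ng // addr0. Qed.

Lemma inertZ N (c : K) f : inert N f -> inert N (c *: f).
Proof. by move=> Nf k Nk; rewrite (derivZ (dP k)) Nf // scaler0. Qed.

Lemma inertM N f g : inert N f -> inert N g -> inert N (f * g).
Proof.
by move=> Nf Ng k Nk; rewrite (derivM (dP k)) Nf // Ng // mul0r mulr0 addr0.
Qed.

(** Each element involves finitely many variables; this makes the infinite sum defining a pivot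
    finite on it. *)
Lemma inert_ex f : exists N, inert N f.
Proof.
elim/t_ind: f => [|f g [M Mf] [N Ng]|c f [N Nf]|i f [N Nf]].
- by exists 0%N => k _; rewrite (deriv1 (dP k)).
- exists (maxn M N); apply: inertD; [apply: inertW Mf|apply: inertW Ng];
    by rewrite leq_max leqnn ?orbT.
- by exists N; exact: inertZ.
exists (maxn i.+1 N); apply: inertM.
  move=> k; rewrite geq_max => /andP[ik _].
  by rewrite dt gtn_eqF.
by apply: inertW Nf; rewrite leq_maxr.
Qed.

Lemma inert_ex2 f g : exists2 N, inert N f & inert N g.
Proof.
have [M Mf] := inert_ex f; have [N Ng] := inert_ex g.
exists (maxn M N); [apply: inertW Mf|apply: inertW Ng];
  by rewrite leq_max leqnn ?orbT.
Qed.

Lemma pivot_ofE N i f : inert N f ->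
  v i f = \sum_(j < N) (\prod_(k < j) t (i.-1 + k)) * d (i + j) f.
Proof.
move=> Nf.
rewrite (fsbig_ord _ _ (fun j => (\prod_(k < j) t (i.-1 + k)) * d (i + j) f)).
apply/esym/fsbig_widen => [//|j [_ /= /negP]].
rewrite -leqNgt => Nj; rewrite Nf ?mulr0 //.
exact: leq_trans Nj (leq_addl _ _).
Qed.

Lemma pivot_of_derivation i : derivation (v i).
Proof.
split=> [f g|c f|f g].
- have [N Nf Ng] := inert_ex2 f g.
  rewrite !(@pivot_ofE N) //; last exact: inertD.
  rewrite -big_split; apply: eq_bigr => j _.
  by rewrite (derivD (dP _)) mulrDr.
- have [N Nf] := inert_ex f.
  rewrite !(@pivot_ofE N) //; last exact: inertZ.
  rewrite scaler_sumr; apply: eq_bigr => j _.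
  by rewrite (derivZ (dP _)) scalerAr.
have [N Nf Ng] := inert_ex2 f g.
rewrite !(@pivot_ofE N) //; last exact: inertM.
rewrite mulr_suml mulr_sumr -big_split; apply: eq_bigr => j _.
by rewrite (derivM (dP _)) /=; ring.
Qed.

Lemma pivot_of_rec n f : v n.+1 f = d n.+1 f + t n * v n.+2 f.
Proof.
have [N Nf] := inert_ex f.
rewrite (@pivot_ofE N.+1) ?(@pivot_ofE N) //; last exact: inertW Nf.
rewrite big_ord_recl big_ord0 mul1r addn0; congr (_ + _).
rewrite mulr_sumr; apply: eq_bigr => j _ /=.
by rewrite prod_recl mulrA [(n.+2 + j)%N]addSnnS.
Qed.

Lemma inert_var j : inert j.+1 (t j).
Proof. by move=> k jk; rewrite dt gtn_eqF. Qed.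

Lemma pivot_of_var_lt n j : (j <= n)%N -> v n.+1 (t j) = 0.
Proof.
move=> jn; rewrite (pivot_ofE _ (@inert_var j)) big1 // => i _.
by rewrite dt gtn_eqF ?mulr0 // ltnS; exact: leq_trans jn (leq_addr _ _).
Qed.

(** Only the summand with d_(n+1+l) sees this variable; its coefficient is collected along the
    recursion for pivots. *)
Lemma pivot_of_var n l : v n.+1 (t (n.+1 + l)) = \prod_(k < l) t (n + k).
Proof.
elim: l n => [|l IH] n; rewrite pivot_of_rec dt.
  by rewrite addn0 eqxx pivot_of_var_lt // mulr0 addr0 big_ord0.
by rewrite -[X in X == _]addn0 eqn_add2l add0r -addSnnS IH prod_recl.
Qed.

Lemma deriv_pivot_of_var n l :
  d n.+1 (v n.+2 (t (n.+3 + l))) = v n.+3 (t (n.+3 + l)).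
Proof.
rewrite [in LHS]addSnnS 2!pivot_of_var.
rewrite prod_recl (derivM (dP _)) dt eqxx mul1r.
rewrite (deriv_prod_eq0 (dP _)) ?mulr0 ?addr0 // => i _.
by rewrite dt ltn_eqF // leq_addr.
Qed.

(** In v_(n+2) = d_(n+2) + t_(n+1) v_(n+3) the variable t_(n+1) occurs only as the displayed
    coefficient, because the coefficients of v_(n+3) start at t_(n+2). *)
Lemma commutator_deriv_pivot_of n :
  commutator (d n.+1) (v n.+2) =1 v n.+3.
Proof.
apply: derivation_ext.
  exact: derivation_commutator (pivot_of_derivation _).
  exact: pivot_of_derivation.
move=> j; rewrite /commutator dt.
have -> : v n.+2 (n.+1 == j)%:R = 0.
  by case: eqP => _; rewrite ?(deriv1 (pivot_of_derivation _)) //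
     (deriv0 (pivot_of_derivation _)).
rewrite subr0; have [jn|nj] := leqP j n.+1.
  by rewrite !pivot_of_var_lt ?(deriv0 (dP _)) // (leq_trans jn).
have [->|jn] := eqVneq j n.+2.
  have := pivot_of_var n.+1 0; rewrite addn0 big_ord0 => ->.
  by rewrite (deriv1 (dP _)) pivot_of_var_lt.
have -> : j = (n.+3 + (j - n.+3))%N by lia.
exact: deriv_pivot_of_var.
Qed.

(** The coefficients of v_(m+1) are products of t_k with k >= m > n. *)
Lemma commutator_deriv_pivot_of0 n m f : (n < m)%N ->
  commutator (d n) (v m.+1) f = 0.
Proof.
move=> nm; move: f; apply: (derivation_ext _ (derivation0 A)) => [|j].
  exact: derivation_commutator (pivot_of_derivation _).
rewrite /commutator dt.
have -> : v m.+1 (n == j)%:R = 0.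
  by case: eqP => _; rewrite ?(deriv1 (pivot_of_derivation _)) //
     (deriv0 (pivot_of_derivation _)).
rewrite subr0; have [jm|mj] := leqP j m.
  by rewrite pivot_of_var_lt // (deriv0 (dP _)).
have -> : j = (m.+1 + (j - m.+1))%N by lia.
rewrite pivot_of_var (deriv_prod_eq0 (dP _)) // => i _.
by rewrite dt ltn_eqF // (leq_trans nm) // leq_addr.
Qed.

(** Expand v_(n+1) = d_(n+1) + t_n v_(n+2); the extra Leibniz term vanishes because v_(m+1) kills
    t_n. *)
Lemma commutator_pivot_of_rec n m f : (n < m)%N ->
  commutator (v n.+1) (v m.+1) f =
  commutator (d n.+1) (v m.+1) f + t n * commutator (v n.+2) (v m.+1) f.
Proof.
move=> nm; rewrite /commutator pivot_of_rec (pivot_of_rec n f).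
have dv := pivot_of_derivation m.+1.
rewrite (derivD dv) (derivM dv) pivot_of_var_lt; last exact: ltnW.
by ring.
Qed.

(** Each step of the recursion contributes one factor t_(n+k) until the two indices are adjacent;
    then d_(n+l+1) and v_(n+l+2) bracket to v_(n+l+3). *)
Lemma commutator_pivot_of n l f :
  commutator (v n.+1) (v (n + l).+2) f =
  (\prod_(k < l) t (n + k)) * v (n + l).+3 f.
Proof.
elim: l n => [|l IH] n.
  rewrite addn0 big_ord0 mul1r commutator_pivot_of_rec //.
  by rewrite commutator_deriv_pivot_of {1}/commutator subrr mulr0 addr0.
rewrite commutator_pivot_of_rec; last by lia.
rewrite commutator_deriv_pivot_of0; last by lia.
by rewrite add0r -addSnnS IH prod_recl mulrA.
Qed.

(** * Pivot monomials, their weights and closure under the bracket *)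

Variables (V : comNzRingType) (w : nat -> V).
Hypothesis wE : forall n, w n.+2 = w n.+1 + w n.

(* The weights of t_i and v_i are - w i and w i. *)
Definition pivot_monomial (e : V) : set (A -> A) := [set D |
  exists n s, [/\ all (fun i => i.+2 <= n)%N s, e = w n.+1 - \sum_(i <- s) w i
    & D = fun f => (\prod_(i <- s) t i) * v n.+1 f]].

(** The sum telescopes, since w k = w (k+2) - w (k+1). It is the weight count behind every bracket
    formula below. *)
Lemma sum_weight n l : \sum_(k < l) w (n + k) = w (n.+1 + l) - w n.+1.
Proof.
elim: l => [|l IH]; first by rewrite big_ord0 addn0 subrr.
by rewrite big_ord_recr /= IH addSnnS 2!addnS wE -addSn addrAC.
Qed.

Lemma span_pivot_of_monomial n m r s : (n < m)%N ->
  all (fun i => i.+2 <= m)%N r -> all (fun i => i.+2 <= m)%N s ->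
  span (pivot_monomial
          (w n.+1 + w m.+1 - \sum_(i <- r) w i - \sum_(i <- s) w i))
    (fun f => (\prod_(i <- r) t i) * v n.+1 (\prod_(i <- s) t i) * v m.+1 f).
Proof.
have dv i := pivot_of_derivation i.
move=> nm; elim: s r => [|p s IH] r mr /=.
  move=> _; rewrite !big_nil (deriv1 (dv _)).
  rewrite [X in span _ X](_ : _ = 0); first exact: span0.
  by apply/funext => f; rewrite mulr0 mul0r.
move=> /andP[pm ms].
rewrite [X in span _ X](_ : _ =
    (fun f => (\prod_(i <- r) t i) * (v n.+1 (t p) * \prod_(i <- s) t i)
              * v m.+1 f) +
    (fun f => (\prod_(i <- p :: r) t i) * v n.+1 (\prod_(i <- s) t i)
              * v m.+1 f)); last first.
  apply/funext => f; rewrite fctE !big_cons (derivM (dv _)).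
  by ring.
apply: spanD; last first.
  have := IH (p :: r) _ ms; rewrite /= pm mr => /(_ isT).
  rewrite !big_cons; congr (span (pivot_monomial _) _).
  by ring.
have [pn|np] := leqP p n.
  rewrite [X in span _ X](_ : _ = 0); first exact: span0.
  by apply/funext => f; rewrite pivot_of_var_lt // mul0r mulr0 mul0r.
have pE : p = (n.+1 + (p - n.+1))%N by lia.
rewrite pE pivot_of_var; apply: span_mem.
exists m, (r ++ [seq (n + k)%N | k <- index_iota 0 (p - n.+1)] ++ s).
split.
- rewrite !all_cat mr ms andbT all_map; apply/allP => k.
  by rewrite mem_index_iota /=; lia.
- rewrite big_cons 2!big_cat big_map /= big_mkord sum_weight.
  by rewrite -pE; ring.
- apply/funext => f; rewrite 2!big_cat big_map /= big_mkord.
  by ring.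
Qed.

(** For n < m, v_(m+1) kills t_r, so the bracket of t_r v_(n+1) and t_s v_(m+1) is t_r v_(n+1)(t_s)
    v_(m+1) + t_r t_s [v_(n+1), v_(m+1)]. The opposite order follows by antisymmetry. *)
Lemma pivot_monomial_commutator e1 e2 D E :
  pivot_monomial e1 D -> pivot_monomial e2 E ->
  span (pivot_monomial (e1 + e2)) (commutator D E).
Proof.
have dv i := pivot_of_derivation i.
have lt_case n m r s : (n < m)%N -> all (fun i => i.+2 <= n)%N r ->
    all (fun i => i.+2 <= m)%N s ->
    span (pivot_monomial
            (w n.+1 - \sum_(i <- r) w i + (w m.+1 - \sum_(i <- s) w i)))
      (commutator (fun f => (\prod_(i <- r) t i) * v n.+1 f)
                  (fun f => (\prod_(i <- s) t i) * v m.+1 f)).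
  move=> nm nr ms.
  have mr : all (fun i => i.+2 <= m)%N r.
    by apply: sub_all nr => i; lia.
  have vr0 : v m.+1 (\prod_(i <- r) t i) = 0.
    rewrite big_seq; apply: (deriv_prod_eq0 (dv _)) => i /(allP nr) /= ni.
    by apply: pivot_of_var_lt; lia.
  rewrite [X in span _ X](_ : _ =
    (fun f => (\prod_(i <- r) t i) * v n.+1 (\prod_(i <- s) t i) * v m.+1 f) +
    (fun f => (\prod_(i <- r) t i) * (\prod_(i <- s) t i)
              * commutator (v n.+1) (v m.+1) f)); last first.
    apply/funext => f; rewrite fctE /commutator.
    rewrite (derivM (dv n.+1)) (derivM (dv m.+1)) vr0.
    by ring.
  apply: spanD.
    have := span_pivot_of_monomial nm mr ms.
    by congr (span (pivot_monomial _) _); ring.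
  have mE : m = (n + (m - n.+1)).+1 by lia.
  rewrite mE; apply: span_mem.
  exists (n + (m - n.+1)).+2.
  exists (r ++ [seq (n + k)%N | k <- index_iota 0 (m - n.+1)] ++ s).
  split.
  - rewrite !all_cat all_map; apply/and3P; split.
    + by apply: sub_all nr => i; lia.
    + by apply/allP => k; rewrite mem_index_iota /=; lia.
    + by apply: sub_all ms => i; lia.
  - rewrite 2!big_cat big_map /= big_mkord sum_weight addSn [w (n + _).+3]wE.
    by ring.
  - apply/funext => f; rewrite 2!big_cat big_map /= big_mkord.
    by rewrite commutator_pivot_of; ring.
move=> [n [r [nr -> ->]]] [m [s [ms -> ->]]].
have [nm|mn|nm] := ltngtP n m.
- exact: lt_case.
- rewrite [X in span _ X](_ : _ =
      - commutator (fun f => (\prod_(i <- s) t i) * v m.+1 f)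
                   (fun f => (\prod_(i <- r) t i) * v n.+1 f)).
    by rewrite addrC; apply: spanN; exact: lt_case.
  by apply/funext => f; rewrite fctE /commutator opprB.
rewrite [X in span _ X](_ : _ = 0); first exact: span0.
(* For equal indices the pivot kills both coefficients, so the two monomials commute. *)
rewrite {}nm in nr *.
have v0 s' : all (fun i => i.+2 <= m)%N s' -> v m.+1 (\prod_(i <- s') t i) = 0.
  move=> ms'; rewrite big_seq.
  apply: (deriv_prod_eq0 (dv _)) => i /(allP ms') /= mi.
  by apply: pivot_of_var_lt; lia.
apply/funext => f; rewrite /commutator !(derivM (dv m.+1)) !v0 //.
by rewrite !mul0r !add0r mulrCA; exact: subrr.
Qed.

Lemma pivot_monomial_derivation e D : pivot_monomial e D -> derivation D.
Proof.
move=> [n [s [_ _ ->]]]; apply: derivation_mull; exact: pivot_of_derivation.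
Qed.

Lemma span_pivot_monomial_derivation e D :
  span (pivot_monomial e) D -> derivation D.
Proof.
move: D; apply: span_ind => [|c D E dD dE|D]; first exact: derivation0.
  exact: derivation_lin.
exact: pivot_monomial_derivation.
Qed.

(** Arbitrary functions need not be additive, so bilinearity of the commutator relies on the spans
    consisting of derivations. *)
Lemma span_pivot_monomial_commutator e1 e2 D E :
  span (pivot_monomial e1) D -> span (pivot_monomial e2) E ->
  span (pivot_monomial (e1 + e2)) (commutator D E).
Proof.
move=> + SE; move: D; apply: span_ind => [|c D D' SD SD'|D SD].
- rewrite [X in span _ X](_ : _ = 0); first exact: span0.
  apply/funext => f; rewrite /commutator.
  by rewrite (deriv0 (span_pivot_monomial_derivation SE)) subr0.
- rewrite [X in span _ X](_ : _ = c *: commutator D E + commutator D' E).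
    exact: span_linear.
  have dE := span_pivot_monomial_derivation SE.
  apply/funext => f; rewrite /commutator !fctE.
  by rewrite (derivD dE) (derivZ dE) scalerBr opprD addrACA.
have dD := pivot_monomial_derivation SD.
move: E SE; apply: span_ind => [|c E E' SE SE'|E SE].
- rewrite [X in span _ X](_ : _ = 0); first exact: span0.
  by apply/funext => f; rewrite /commutator (deriv0 dD) subr0.
- rewrite [X in span _ X](_ : _ = c *: commutator D E + commutator D E').
    exact: span_linear.
  apply/funext => f; rewrite /commutator !fctE.
  by rewrite (derivD dD) (derivZ dD) scalerBr opprD addrACA.
exact: pivot_monomial_commutator.
Qed.

Hypothesis t_sq : forall i, t i * t i = 0.

Lemma prod_var_uniq s : \prod_(i <- s) t i = 0 \/ uniq s.
Proof.
elim: s => [|i s [IH|us]]; [by right|by left; rewrite big_cons IH mulr0|].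
rewrite big_cons /= us andbT; have [si|] := boolP (i \in s); last by right.
left; by rewrite (big_rem i si) mulrA t_sq mul0r.
Qed.

(** A repeated index gives the zero map because t_i^2 = 0. Repetitions are discarded only here, so
    the bracket computations can concatenate lists freely. *)
Lemma span_pivot_monomial_uniq e :
  span (pivot_monomial e) `<=` span [set D |
    exists n s, [/\ all (fun i => i.+2 <= n)%N s, uniq s,
      e = w n.+1 - \sum_(i <- s) w i
    & D = fun f => (\prod_(i <- s) t i) * v n.+1 f]].
Proof.
apply: span_sub => _ [n [s [ns eE ->]]].
have [t0|us] := prod_var_uniq s; last by apply: span_mem; exists n, s.
rewrite [X in span _ X](_ : _ = 0); first exact: span0.
by apply/funext => f; rewrite t0 mul0r.
Qed.

(** The condition i + 2 <= n reads i < n - 1, so index lists become subsets of ['I_n.-1]; for n = 0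
    truncation leaves only the empty set. *)
Definition pivot_monomial_fam N (T : {n : 'I_N & {set 'I_n.-1}}) : A -> A :=
  fun f => (\prod_(i in tagged T) t i) * v (tag T).+1 f.

Lemma span_pivot_monomial_fam N e :
    (forall n s, all (fun i => i.+2 <= n)%N s -> uniq s ->
       e = w n.+1 - \sum_(i <- s) w i -> (n < N)%N) ->
  span (pivot_monomial e) `<=` span (range (@pivot_monomial_fam N)).
Proof.
move=> eN; apply: (subset_trans (@span_pivot_monomial_uniq e)).
apply: span_sub => _ [n [s [ns us eE ->]]]; apply: span_mem.
pose n' := Ordinal (eN n s ns us eE).
exists (Tagged (fun n : 'I_N => {set 'I_n.-1}) (i := n')
                [set i | val i \in s]%SET) => //.
apply/funext => f; rewrite /pivot_monomial_fam /=; congr (_ * _).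
rewrite (@big_uniq_ord _ _ _ s n.-1) // => [|i /(allP ns) /=]; last by lia.
by apply: eq_bigl => i; rewrite inE.
Qed.

End Pivots.

(** * Linear independence, dimension and quotients *)

Section LinearAlgebra.
Variables (K : fieldType) (V : lmodType K).

Lemma span_rangeP (T : finType) (g : T -> V) y :
  span (range g) y -> exists a : T -> K, y = \sum_i a i *: g i.
Proof.
move=> [s + ->]; elim: s => [_|[c z] s IH gs].
  by exists (fun=> 0); rewrite big_nil big1 // => i _; rewrite scale0r.
have [a aE] : exists a : T -> K,
    \sum_(cv <- s) cv.1 *: cv.2 = \sum_i a i *: g i.
  by apply: IH => cv cvs; apply: gs; rewrite inE cvs orbT.
have [j _ /= gj] := gs (c, z) (mem_head _ _).
exists (fun i => c *+ (i == j) + a i); rewrite big_cons aE /= -gj.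
rewrite [RHS](eq_bigr (fun i => (c *+ (i == j)) *: g i + a i *: g i));
  last by move=> i _; rewrite scalerDl.
rewrite big_split /=; congr (_ + _).
rewrite (bigD1 j) //= eqxx big1 ?addr0 // => i /negbTE ->.
by rewrite scale0r.
Qed.

(** If n exceeded the size of the family, the coefficient matrix would have more rows than columns;
    a nonzero vector of its left kernel would be a linear relation among the x_i. *)
Lemma lin_indep_card n (x : 'I_n -> V) (T : finType) (g : T -> V) :
  lin_indep x -> (forall i, span (range g) (x i)) -> (n <= #|T|)%N.
Proof.
move=> indep_x gx; rewrite leqNgt; apply/negP => Tn.
have [a aE] := boolp.choice (fun i => span_rangeP (gx i)).
pose M : 'M[K]_(n, #|T|) := \matrix_(i, k) a i (enum_val k).
have : kermx M != 0.
  rewrite -mxrank_eq0 mxrank_ker subn_eq0 -ltnNge.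
  exact: leq_ltn_trans (rank_leq_col M) Tn.
case/rowV0Pn => u /sub_kermxP uM /eqP; apply; apply/rowP => i.
rewrite mxE; apply: (indep_x (fun i => u 0 i)).
transitivity (\sum_i \sum_k (u 0 i * a i k) *: g k).
  apply: eq_bigr => j _; rewrite [X in _ *: X]aE scaler_sumr.
  by apply: eq_bigr => k _; rewrite scalerA.
rewrite exchange_big big1 // => k _; rewrite -scaler_suml.
suff -> : \sum_i0 u 0 i0 * a i0 k = 0 by rewrite scale0r.
have := congr1 (fun B : 'rV_#|T| => B 0 (enum_rank k)) uM.
by rewrite !mxE => {2}<-; apply: eq_bigr => j _; rewrite mxE enum_rankK.
Qed.

Lemma lin_indep_inj m n (x : 'I_n -> V) (h : 'I_m -> 'I_n) :
  injective h -> lin_indep x -> lin_indep (x \o h).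
Proof.
move=> inj_h ux c cx i.
(* The coefficients are extended by zero outside the image of [h]. *)
pose c' j := if [pick k | h k == j] is Some k then c k else 0.
have c'h k : c' (h k) = c k.
  rewrite /c'; case: pickP => [k' /eqP/inj_h ->//|/(_ k)].
  by rewrite eqxx.
rewrite -c'h; apply: ux; rewrite -[RHS]cx.
rewrite (bigID (mem (codom h))) /= [X in _ + X]big1 ?addr0 => [|j hj];
  last first.
  rewrite /c'; case: pickP => [k /eqP kj|_]; last by rewrite scale0r.
  by rewrite -kj codom_f in hj.
rewrite -big_uniq /=; last by rewrite map_inj_uniq ?enum_uniq.
rewrite big_map big_enum /=.
by apply: eq_bigr => k _; rewrite c'h.
Qed.

(** As 0 is the default value of [dim], a nonzero dimension comes from an actual nonempty basis. *)
Lemma dim_neq0 (S : set V) : dim S != 0%N -> exists2 x, S x & x != 0.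
Proof.
rewrite /dim; case: xgetP => [d _ [v [Sv indep_v _]] d_gt0|]; last first.
  by rewrite eqxx.
case: d v Sv indep_v d_gt0 => // d v Sv indep_v _.
exists (v ord0); first exact: Sv.
apply/eqP => v0; have /eqP : (1 : K) = 0; last by rewrite oner_eq0.
rewrite -[1]/((fun i : 'I_d.+1 => (i == ord0)%:R : K) ord0).
apply: (indep_v (fun i => (i == ord0)%:R)).
rewrite (bigD1 ord0) //= v0 scaler0 add0r big1 // => i /negbTE ->.
by rewrite scale0r.
Qed.

Lemma span_neq0 (S : set V) x : span S x -> x != 0 -> exists2 y, S y & y != 0.
Proof.
move=> [s Ss ->] s0; apply: contrapT => S0; case/eqP: s0.
rewrite big_seq big1 // => cv cvs; apply/eqP; rewrite scaler_eq0.
apply/orP; right; apply: contrapT => /negP v0; apply: S0.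
by exists cv.2 => //; exact: Ss.
Qed.

Lemma qclassZ (S : set V) c x : c *: qclass S x = qclass S (c *: x).
Proof. exact: qscale_class. Qed.

Lemma qclass0 (S : set V) : qclass S 0 = 0.
Proof. by rewrite -(scale0r 0) -qclassZ scale0r. Qed.

End LinearAlgebra.

(** * Nonzero wedges, exterior powers and homology *)

Section Wedge.
Variables (K : fieldType) (L : lmodType K).

Definition upd n (x : {ffun 'I_n -> L}) i y : {ffun 'I_n -> L} :=
  [ffun k => if k == i then y else x k].

Lemma updK n (x : {ffun 'I_n -> L}) i : upd x i (x i) = x.
Proof. by apply/ffunP => k; rewrite ffunE; case: eqP => [->|]. Qed.

Lemma wedge_upd_lin n (x : {ffun 'I_n -> L}) i c y z :
  wedge (upd x i (c *: y + z)) = c *: wedge (upd x i y) + wedge (upd x i z).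
Proof.
rewrite /wedge qclassZ -qclassD; apply/eq_qclass; apply: span_mem; left.
exists i, c, (upd x i (c *: y + z)), (upd x i y), (upd x i z); split.
- by rewrite !ffunE eqxx.
- by move=> j /negbTE ji; rewrite !ffunE ji.
by rewrite opprD addrA.
Qed.

Lemma wedge_alternating n (x : {ffun 'I_n -> L}) i j :
  i != j -> x i = x j -> wedge x = 0.
Proof.
move=> ij xij; rewrite /wedge -(qclass0 (_ `|` _)).
by apply/eq_qclass; rewrite subr0; apply: span_mem; right; exists i, j, x.
Qed.

(** Put a vanishing combination with c_i != 0 into slot i and expand: every term with j != i has a
    repeated factor, so c_i times the wedge is 0. *)
Lemma wedge_lin_indep n (x : {ffun 'I_n -> L}) : wedge x != 0 -> lin_indep x.
Proof.
move=> x_neq0 c cx0 i; apply: contrapT => /eqP ci; case/eqP: x_neq0.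
pose f y := wedge (upd x i y).
have f_lin a y z : f (a *: y + z) = a *: f y + f z by exact: wedge_upd_lin.
have f0 : f 0 = 0.
  by have := f_lin (-1) 0 0; rewrite scaler0 addr0 scaleN1r addNr.
have fS (s : seq 'I_n) :
    f (\sum_(j <- s) c j *: x j) = \sum_(j <- s) c j *: f (x j).
  by elim: s => [|j s IH]; rewrite ?big_nil // !big_cons f_lin IH.
have := fS (index_enum 'I_n); rewrite cx0 f0 (bigD1 i) //= big1 => [|j ji].
  rewrite addr0 /f updK => /esym/eqP; rewrite scaler_eq0 (negPf ci) /=.
  by move/eqP.
rewrite /f (wedge_alternating ji) ?scaler0 //.
by rewrite !ffunE eqxx (negPf ji).
Qed.

Variables (br : L -> L -> L) (gr : nat -> nat -> set L).

Lemma ext_comp_neq0 n a b (w : ext L n) : ext_comp gr a b w -> w != 0 ->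
  exists (d e : 'I_n -> nat) (x : {ffun 'I_n -> L}),
    [/\ forall i, gr (d i) (e i) (x i), (\sum_(i < n) d i)%N = a,
        (\sum_(i < n) e i)%N = b & lin_indep x].
Proof.
move=> /span_neq0/[apply] -[_ [d [e [x [grx da eb ->]]]] /wedge_lin_indep ux].
by exists d, e, x.
Qed.

Lemma homology_comp_neq0 n a b (h : mod_boundaries br n) :
  homology_comp gr a b h -> h != 0 ->
  exists2 w : ext L n, ext_comp gr a b w & w != 0.
Proof.
move=> [w [_ gw] <-] w0; exists w => //.
by apply: contra_neq w0 => ->; exact: qclass0.
Qed.

End Wedge.

(** * From nonzero coefficients to independent homogeneous families *)

Section Series.
Variable K : fieldType.

(** The common consequence of nonvanishing of the exterior power and of homology in bidegree (a, b);
    the estimates start from it alone. *)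
Definition independent_family n a b :=
  exists (d e : 'I_n -> nat) (x : 'I_n -> fib K),
  [/\ forall i, fib_comp (d i) (e i) (x i), (\sum_(i < n) d i)%N = a,
      (\sum_(i < n) e i)%N = b & lin_indep x].

Lemma hilbert_ext_neq0 n a b :
  hilbert_ext K n a b != 0%N -> independent_family n a b.
Proof.
move=> /dim_neq0[w Ew w0]; have [d [e [x [? ? ? ?]]]] := ext_comp_neq0 Ew w0.
by exists d, e, x.
Qed.

Lemma hilbert_homology_neq0 n a b :
  hilbert_homology K n a b != 0%N -> independent_family n a b.
Proof.
move=> /dim_neq0[h Hh /(homology_comp_neq0 Hh)[w Ew w0]].
by have [d [e [x [? ? ? ?]]]] := ext_comp_neq0 Ew w0; exists d, e, x.
Qed.

Lemma euler_char_neq0 a b : (a, b) != (0%N, 0%N) -> euler_char K a b != 0 ->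
  exists2 n, (0 < n)%N & independent_family n a b.
Proof.
move=> ab0 Eab; have [n En] : exists n, hilbert_ext K n a b != 0%N.
  apply: contrapT => E0; case/eqP: Eab; apply: fsbig1 => n _.
  have [->|/eqP n0] := eqVneq (hilbert_ext K n a b) 0%N; first by rewrite mulr0.
  by case: E0; exists n; exact/eqP.
exists n; last exact: hilbert_ext_neq0.
(* For n = 0 the empty sums force (a, b) = (0, 0), which is excluded. *)
case: n En => // /hilbert_ext_neq0[d [e [x [_ + + _]]]].
by rewrite !big_ord0 => a0 b0; rewrite -a0 -b0 eqxx in ab0.
Qed.

End Series.

(** Bounding 2^(n-1) by 2^n leaves a geometric sum equal to 2^N - 1. *)
Lemma card_tagged_sets_lt N : (#|{: {n : 'I_N & {set 'I_n.-1}}}| < 2 ^ N)%N.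
Proof.
rewrite card_tagged sumnE big_map big_enum /=.
rewrite (@leq_ltn_trans (\sum_(i < N) 2 ^ i)) //.
  apply: leq_sum => i _.
  rewrite -cardsT -powersetT card_powerset cardsT card_ord.
  by rewrite leq_exp2l // leq_pred.
elim: N => [|N IH]; first by rewrite big_ord0.
by rewrite big_ord_recr /= expnS mul2n -addnn ltn_add2r.
Qed.

(** * Weights given by powers of the golden ratio *)

Section GoldenRatio.
Variable R : realType.
Local Notation l := (golden R).

Lemma golden_sqr : l ^+ 2 = l + 1.
Proof.
have s5 : Num.sqrt (5 : R) ^+ 2 = 5 by rewrite sqr_sqrtr.
rewrite /golden; set s := Num.sqrt 5 in s5 *.
by nra.
Qed.

Lemma golden_gt1 : 1 < l.
Proof.
have : 1 < Num.sqrt (5 : R) by rewrite -[ltLHS]sqrtr1 ltr_sqrt ?ltr1n.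
by rewrite /golden; lra.
Qed.

Lemma golden_gt0 : 0 < l. Proof. exact: lt_trans ltr01 golden_gt1. Qed.

Lemma golden_inv : l^-1 = l - 1.
Proof.
have l0 : l != 0 by rewrite gt_eqF // golden_gt0.
apply: (mulfI l0).
by rewrite mulfV // mulrBr -expr2 golden_sqr mulr1 addrC addKr.
Qed.

(* 1 - lambda = - 1 / lambda is the conjugate of lambda. *)
Definition golden_weight n : R * R := (l ^+ n, (1 - l) ^+ n).
Local Notation w := golden_weight.

Lemma golden_weightE n : w n.+2 = w n.+1 + w n.
Proof.
have g2 := golden_sqr; congr (_, _) => /=; rewrite !exprSr -mulrA.
  by rewrite -expr2 g2 mulrDr mulr1.
have -> : (1 - l) * (1 - l) = (1 - l) + 1 by nra.
by rewrite mulrDr mulr1.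
Qed.

(** Identifies the total weight of a factors v_1 and b factors v_2 with the weight coordinates of
    (a, b), using 1 - lambda = -1/lambda. *)
Lemma golden_weight_comb a b :
  w 1 *+ a + w 2 *+ b = (weight_xi a%:R b%:R, weight_eta a%:R b%:R).
Proof.
have g2 := golden_sqr.
have E n (x : R * R) : x *+ n = (n%:R * x.1, n%:R * x.2).
  elim: n => [|n IH]; first by rewrite !mul0r.
  by rewrite mulrS IH -natr1; congr (_, _) => /=; ring.
rewrite !E /weight_xi /weight_eta; congr (_, _) => //=.
by rewrite -exprVn golden_inv; ring.
Qed.

Lemma ler_sum_uniq (s : seq nat) n (F : nat -> R) : (forall i, 0 <= F i) ->
  uniq s -> {in s, forall i, i < n}%N -> \sum_(i <- s) F i <= \sum_(i < n) F i.
Proof.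
move=> F0 us sn; rewrite (big_uniq_ord _ _ us sn) big_mkcond /=.
by apply: ler_sum => i _; case: ifP.
Qed.

(** For n >= 1 the subtracted sum is at most lambda^0 + ... + lambda^(n-2) <= lambda^n, and
    lambda^(n+1) - lambda^n = lambda^(n-1). The factor lambda^2 avoids a negative exponent at n = 0,
    where [s] is empty. *)
Lemma weight_xi_ge n s : all (fun i => i.+2 <= n)%N s -> uniq s ->
  l ^+ n.+1 <= (w n.+1 - \sum_(i <- s) w i).1 * l ^+ 2.
Proof.
move=> ns us; have g1 := golden_gt1; have g2 := golden_sqr.
have fst_sum (r : seq nat) : (\sum_(i <- r) w i).1 = \sum_(i <- r) l ^+ i.
  by elim: r => [|i r IH]; rewrite ?big_nil // !big_cons -IH.
rewrite /= fst_sum; case: n ns => [|n] ns.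
  case: s ns {us} => //= _; rewrite big_nil subr0 expr1.
  by rewrite ler_peMr ?exprn_ege1 // ltW // golden_gt0.
have : \sum_(i <- s) l ^+ i <= l ^+ n.+1.
  apply: (le_trans (@ler_sum_uniq s n _ _ us _)) => [i|i /(allP ns) //|].
    by rewrite exprn_ge0 // ltW // golden_gt0.
  elim: n {ns} => [|n IH].
    by rewrite big_ord0 exprn_ge0 // ltW // golden_gt0.
  have := congr1 fst (golden_weightE n); rewrite big_ord_recr /= => ->.
  by rewrite lerD2r.
have : 0 <= l ^+ n.+1 by rewrite exprn_ge0 // ltW // golden_gt0.
rewrite [_ ^+ n.+2]exprSr.
set x := l ^+ n.+1; set S := \sum_(i <- s) _ => x0 Sx.
have : x * l <= (x * l - x) * l ^+ 2.
  suff -> : (x * l - x) * l ^+ 2 = x * l by [].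
  transitivity (x * (l * (l ^+ 2 - l))); first by ring.
  by rewrite g2 addrAC subrr add0r mulr1.
have : 0 <= (x - S) * l ^+ 2.
  by rewrite mulr_ge0 ?subr_ge0 // exprn_ge0 // ltW // golden_gt0.
by lra.
Qed.

(** The conjugate has absolute value lambda - 1 < 1, so the leading term is at most 1 and the sum is
    bounded by the geometric series 1 / (2 - lambda) = lambda^2. *)
Lemma weight_eta_le n s : all (fun i => i.+2 <= n)%N s -> uniq s ->
  `|(w n.+1 - \sum_(i <- s) w i).2| <= 1 + l ^+ 2.
Proof.
move=> ns us; have g1 := golden_gt1; have g2 := golden_sqr.
have l2 : l < 2 by nra.
have snd_sum (r : seq nat) : (\sum_(i <- r) w i).2 = \sum_(i <- r) (1 - l) ^+ i.
  by elim: r => [|i r IH]; rewrite ?big_nil // !big_cons -IH.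
rewrite /= snd_sum; apply: (le_trans (ler_normB _ _)); apply: lerD.
  by rewrite normrX exprn_ile1 // ler_norml; apply/andP; split; lra.
apply: (le_trans (ler_norm_sum _ _ _)).
under eq_bigr do rewrite normrX ltr0_norm ?subr_lt0 // opprB.
apply: (le_trans (@ler_sum_uniq s n _ _ us _)) => [i|i /(allP ns)/ltnW //|].
  by rewrite exprn_ge0 // subr_ge0 ltW.
have -> : \sum_(i < n) (l - 1) ^+ i = l ^+ 2 * (1 - (l - 1) ^+ n).
  have g4 : l ^+ 2 * (2 - l) = 1 by nra.
  elim: n {ns} => [|n IH]; first by rewrite big_ord0 subrr mulr0.
  rewrite big_ord_recr /= IH [(l - 1) ^+ n.+1]exprSr; set c := (l - 1) ^+ n.
  transitivity (l ^+ 2 * (1 - c) + c * (l ^+ 2 * (2 - l))); last by ring.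
  by rewrite g4 mulr1.
have : 0 <= (l - 1) ^+ n by rewrite exprn_ge0 // subr_ge0 ltW.
by nra.
Qed.

(** Here 2 lambda = 1 + sqrt 5, and theta is the exponent taking 1 + sqrt 5 to 2. *)
Lemma golden_powR_theta n : ((2 * l) ^+ n) `^ theta R = 2 ^+ n.
Proof.
have -> : 2 * l = 1 + Num.sqrt 5 by rewrite /golden; lra.
have s1 : 1 < 1 + Num.sqrt 5 :> R by rewrite ltrDl sqrtr_gt0.
have s0 := lt_trans ltr01 s1.
rewrite -powR_mulrn ?ltW // -powRrM mulrC powRrM.
suff -> : (1 + Num.sqrt 5) `^ theta R = 2 :> R by rewrite powR_mulrn.
rewrite /powR gt_eqF // /theta divfK ?lnK ?posrE //.
by rewrite gt_eqF // ln_gt0.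
Qed.

End GoldenRatio.

(** * Graded components of the Fibonacci Lie algebra inside spans of pivot monomials *)

Section FibonacciPivots.
Variables (K : fieldType) (charK : 2%N \in [pchar K]).
Variables (V : comNzRingType) (w : nat -> V).
Hypothesis wE : forall n, w n.+2 = w n.+1 + w n.

Local Notation monomial e :=
  (@pivot_monomial K (trunc K) (@tvar K) (@pderiv K) V w e).

Lemma pderiv_derivation i : derivation (@pderiv K i).
Proof.
by split=> [f g|c f|f g]; [exact: pderivD|exact: pderivZ|exact: pderivM].
Qed.

(** Induction on the commutator: [pivot] unfolds to [pivot_of] for [tvar] and [pderiv], so the
    generators are monomials with empty list, and weights add under brackets. *)
Lemma fib_commutator_span a b (x : fib K) : fib_commutator a b x ->
  span (monomial (w 1 *+ a + w 2 *+ b)) (fib_val x).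
Proof.
have piv1 n : monomial (w n.+1) (@pivot K n.+1).
  exists n, [::]; split => //; first by rewrite big_nil subr0.
  by apply/funext => f; rewrite big_nil mul1r.
elim=> {a b x} [||a b a' b' x x' _ IH _ IH'].
- by rewrite mulr1n mulr0n addr0; apply: span_mem; exact: piv1.
- by rewrite mulr1n mulr0n add0r; apply: span_mem; exact: piv1.
rewrite !mulrnDr addrACA.
exact: (span_pivot_monomial_commutator pderiv_derivation (pderiv_var charK)
         (@trunc_ind K) wE IH IH').
Qed.

Lemma fib_val_lin (c : K) (x y : fib K) :
  fib_val (c *: x + y) = c *: fib_val x + fib_val y.
Proof. by []. Qed.

Lemma fib_comp_span a b (x : fib K) : fib_comp a b x ->
  span (monomial (w 1 *+ a + w 2 *+ b)) (fib_val x).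
Proof.
move: x; apply: span_ind => [|c y z Sy Sz|x]; first exact: span0.
  by rewrite fib_val_lin; exact: span_linear.
exact: fib_commutator_span.
Qed.

(** The monomials are maps on [trunc K] not shown to lie in [fib K], so dimensions are counted in
    the ambient space of maps. *)
Lemma fib_val_lin_indep n (x : 'I_n -> fib K) :
  lin_indep x -> lin_indep (fun i => fib_val (x i)).
Proof.
move=> ux c cx; apply: ux; apply: val_inj => /=; rewrite -[RHS]cx.
elim/big_rec2: _ => [//|i y1 y2 _ <-].
exact: fib_val_lin.
Qed.

End FibonacciPivots.

(** * Growth estimates and the parabola-like bound *)

Section Bounds.
Variables (K : fieldType) (charK : 2%N \in [pchar K]) (R : realType).
Local Notation l := (golden R).
Local Notation xi d e := (weight_xi (d%:R : R) (e%:R : R)).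
Local Notation eta d e := (weight_eta (d%:R : R) (e%:R : R)).

Let pder := pderiv_derivation charK.
Let wE := @golden_weightE R.

Lemma fib_comp_eta a b (x : fib K) : fib_comp a b x -> x != 0 ->
  `|eta a b| <= 1 + l ^+ 2.
Proof.
move=> /(fib_comp_span charK wE); rewrite golden_weight_comb => Sx x0.
have := span_pivot_monomial_uniq (@tvar_sq K) Sx.
(* A nonzero element forces some monomial of this weight to exist, and [weight_eta_le] applies to
   it. *)
case/span_neq0; first exact: x0.
by move=> _ [n [s [ns us eE _]]] _; have := weight_eta_le R ns us; rewrite -eE.
Qed.

(** By [weight_xi_ge] such a small xi admits only monomials with pivot index below N, and there are
    fewer than 2^N of these; independence bounds the number of elements. *)
Lemma card_small_xi n (d e : 'I_n -> nat) (x : 'I_n -> fib K) N :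
    (forall i, fib_comp (d i) (e i) (x i)) -> lin_indep x ->
  (#|[set i | (xi (d i) (e i) * l ^+ 2 < l ^+ N)%R]%SET| < 2 ^ N)%N.
Proof.
move=> gx ux; set A := finset _.
apply: leq_ltn_trans (card_tagged_sets_lt N).
apply: (lin_indep_card (x := (fun i => fib_val (x i)) \o (enum_val (A := A)))
          (g := @pivot_monomial_fam K (trunc K) (@tvar K) (@pderiv K) N)).
  by apply: lin_indep_inj (fib_val_lin_indep ux); exact: enum_val_inj.
move=> j /=; set i := enum_val j.
have /= := enum_valP j; rewrite inE -/i => xi_lt.
have := fib_comp_span charK wE (gx i); rewrite golden_weight_comb.
apply: (span_pivot_monomial_fam (@tvar_sq K)) => m s ms us eE.
have := weight_xi_ge R ms us; rewrite -eE /= => /le_lt_trans/(_ xi_lt).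
by rewrite ltr_eXn2l ?golden_gt1 //; exact: ltnW.
Qed.

Lemma weight_xi_ge0 (a b : nat) : 0 <= xi a b.
Proof.
by rewrite addr_ge0 // mulr_ge0 // ?exprn_ge0 // ltW // golden_gt0.
Qed.

Lemma weight_xi_sum n (d e : 'I_n -> nat) :
  xi (\sum_i d i)%N (\sum_i e i)%N = \sum_i xi (d i) (e i).
Proof. by rewrite /weight_xi big_split -!mulr_suml /= !natr_sum. Qed.

Lemma weight_eta_sum n (d e : 'I_n -> nat) :
  eta (\sum_i d i)%N (\sum_i e i)%N = \sum_i eta (d i) (e i).
Proof. by rewrite /weight_eta big_split -!mulr_suml /= !natr_sum sumrN. Qed.

Lemma size_le_xi n a b : independent_family K n a b -> (0 < n)%N ->
  n%:R < 4 * (xi a b * l ^+ 2) `^ theta R.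
Proof.
move=> [d [e [x [gx <- <- ux]]]] n0.
(* M is one less than the binary logarithm of n, or 0 when n = 1; the bound by n + 1 rather than n
   covers that case. *)
have [M M1 M2] : exists2 M, (2 ^ M + 2 ^ M <= n.+1)%N & (n < 4 * 2 ^ M)%N.
  have := trunc_log_bounds (isT : (1 < 2)%N) n0.
  case: (trunc_log 2 n) => [|M] /andP[]; first by move=> _ n1; exists 0%N; lia.
  by rewrite !expnS => ? ?; exists M; lia.
pose f i := xi (d i) (e i) * l ^+ 2.
have l0 : 0 <= l by rewrite ltW // golden_gt0.
have f0 i : 0 <= f i by rewrite mulr_ge0 ?weight_xi_ge0 ?exprn_ge0.
have cardA := card_small_xi M gx ux; set A := finset _ in cardA.
(* At most 2^M - 1 of the n elements are small, which leaves at least n + 1 - 2^M >= 2^M others. *)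
have cardAC : (2 ^ M <= #|~: A|)%N.
  by rewrite cardsCs finset.setCK card_ord; lia.
(* At least 2^M terms are each at least lambda^M; raising to the power theta turns (2 lambda)^M into
   2^M > n / 4. *)
have sum_ge : (2 * l) ^+ M <= \sum_i f i.
  rewrite (bigID (mem (~: A))) /= -[leLHS]addr0.
  apply: lerD; last exact: sumr_ge0.
  apply: (@le_trans _ _ (\sum_(i in ~: A) l ^+ M)).
    rewrite sumr_const exprMn -[leRHS]mulr_natl ler_wpM2r ?exprn_ge0 //.
    by rewrite -natrX ler_nat.
  by apply: ler_sum => i; rewrite !inE -leNgt.
rewrite weight_xi_sum mulr_suml.
apply: (@lt_le_trans _ _ (4 * 2 ^+ M)); first by rewrite -natrX -natrM ltr_nat.
rewrite ler_pM2l ?ltr0n // -golden_powR_theta.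
have theta0 : 0 <= theta R.
  by rewrite /theta divr_ge0 // ln_ge0 ?ler1n // lerDl sqrtr_ge0.
apply: ge0_ler_powR; rewrite ?nnegrE //; last first.
  by apply: sumr_ge0 => i _; exact: f0.
by rewrite exprn_ge0 // mulr_ge0.
Qed.

(** Each of the n members contributes at most 1 + lambda^2 to |eta|, and [size_le_xi] bounds n;
    splitting the power of xi lambda^2 gives the constant. *)
Lemma independent_family_bound n a b :
  independent_family K n a b -> (0 < n)%N ->
  `|eta a b| < (1 + l ^+ 2) * (4 * (l ^+ 2) `^ theta R) * xi a b `^ theta R.
Proof.
move=> Fx n0; have l0 : 0 <= l by rewrite ltW // golden_gt0.
have c0 : 0 < 1 + l ^+ 2 by rewrite ltr_wpDr ?exprn_ge0.
apply: (@le_lt_trans _ _ ((1 + l ^+ 2) * n%:R)); last first.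
  rewrite -mulrA ltr_pM2l // -mulrA [X in _ * X]mulrC.
  rewrite -powRM ?weight_xi_ge0 ?exprn_ge0 //; exact: size_le_xi Fx n0.
case: Fx => d [e [x [gx <- <- ux]]].
rewrite weight_eta_sum (le_trans (ler_norm_sum _ _ _)) //.
rewrite mulr_natr -[X in _ *+ X]card_ord -sumr_const; apply: ler_sum => i _.
(* A member of an independent family is nonzero: otherwise the coefficients concentrated at i would
   give a relation. *)
apply: fib_comp_eta (gx i) _; apply/eqP => xi0.
have := ux (fun j => (j == i)%:R); rewrite (bigD1 i) //= xi0 scaler0 add0r.
rewrite big1 => [/(_ erefl i)/eqP|j /negbTE ->]; last by rewrite scale0r.
by rewrite eqxx oner_eq0.
Qed.

End Bounds.

Theorem theorem52 (K : fieldType) (charK : 2%N \in [pchar K]) (R : realType) :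
  exists2 C : R, 0 < C &
    (forall a b : nat, (a, b) != (0%N, 0%N) -> euler_char K a b != 0 ->
       `|weight_eta (a%:R : R) b%:R| < C * weight_xi (a%:R : R) b%:R `^ theta R)
    /\
    (forall n a b : nat, (1 <= n)%N -> hilbert_homology K n a b != 0%N ->
       `|weight_eta (a%:R : R) b%:R| < C * weight_xi (a%:R : R) b%:R `^ theta R).
Proof.
exists ((1 + golden R ^+ 2) * (4 * (golden R ^+ 2) `^ theta R)).
  have l0 := golden_gt0 R.
  by rewrite mulr_gt0 ?mulr_gt0 ?powR_gt0 ?exprn_gt0 // addr_gt0 ?exprn_gt0.
split=> [a b ab0 /(euler_char_neq0 ab0)[n n0 Fx]
        |n a b n0 /hilbert_homology_neq0 Fx].
  exact: independent_family_bound Fx n0.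
exact: independent_family_bound Fx n0.
Qed.
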